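(* Let $c_0$ be a proper $4$-colouring of the plane, let $\mu$ be a left-invariant finitely additive probability measure on $S_4\times E(2)$, and let $p_d$ be the associated monochromaticity probabilities (see context). Then for real $d\ge0$: (1) if $d\le\frac{\sqrt6-\sqrt2}{2}$, then $p_d\ge\frac1{50}$; (2) if $\frac{\sqrt6-\sqrt2}{2}<d\le\sqrt{\frac{14}{15}}-\frac1{\sqrt5}$, then $p_d\ge\frac{14}{775}$; (3) if $\sqrt{\frac{14}{15}}-\frac1{\sqrt5}<d\le\frac{\sqrt{15}}4-\frac{\sqrt3}4$, then $p_d\ge\frac1{100}$; (4) if $\frac{\sqrt{15}+\sqrt3}{4}\le d<\sqrt{\frac{14}{15}}+\frac1{\sqrt5}$, then $p_d\ge\frac1{100}$; (5) if $\sqrt{\frac{14}{15}}+\frac1{\sqrt5}\le d<\sqrt2$, then $p_d\ge\frac{14}{775}$; (6) if $\sqrt2\le d<2$, then $p_d\ge\frac1{50}$.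
   Context: Identify the plane with $\mathbb C$. A proper $4$-colouring of the plane is a map $c_0:\mathbb C\to\{1,2,3,4\}$ such that no two points at distance $1$ have the same colour. Let $S_4$ be the group of permutations of the colours and $E(2)$ the group of Euclidean isometries of the plane. The group $S_4\times E(2)$ is amenable, so there is a finitely additive probability measure $\mu$ defined on all subsets of $S_4\times E(2)$ which is left-invariant, i.e. $\mu(gE)=\mu(E)$ for all $g\in S_4\times E(2)$ and $E\subseteq S_4\times E(2)$. For $(\sigma,T)\in S_4\times E(2)$ consider the (random) colouring $c=\sigma\circ c_0\circ T^{-1}$. For $d\ge 0$, $p_d$ denotes the probability that two points $A,B$ at distance $d$ get the same colour: $p_d=\mu(\{(\sigma,T): c(A)=c(B)\})$; by left-invariance this does not depend on the choice of $A,B$ with $|AB|=d$. The existence of $c_0$ is a standing assumption, and $c_0,\mu$ are arbitrary but fixed. *)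

(* Defs.v *)
From HB Require Import structures.
From mathcomp Require Import all_boot all_order all_algebra all_fingroup.
From mathcomp Require Import all_classical reals.
From mathcomp Require Import complex.

Set Implicit Arguments.
Unset Strict Implicit.
Unset Printing Implicit Defensive.

Import Order.TTheory GRing.Theory Num.Theory.
Local Open Scope classical_set_scope.
Local Open Scope ring_scope.

(* The plane is R[i].  The library norm `|z| on R[i] takes values in R[i],
   whereas [normc] is the real-valued modulus sqrt (Re z ^ 2 + Im z ^ 2). *)
Definition edist (R : realType) (A B : R[i]) : R :=
  ComplexField.Normc.normc (A - B).

(* E(2).  The inverse map is carried along only so that T^-1 can be computed;
   it is determined by [iso_fun] (see [plane_isometry_eq]). *)
Record plane_isometry (R : realType) := Isometry {
  iso_fun :> R[i] -> R[i];
  iso_inv : R[i] -> R[i];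
  iso_funK : cancel iso_fun iso_inv;
  iso_invK : cancel iso_inv iso_fun;
  iso_dist : forall A B, edist (iso_fun A) (iso_fun B) = edist A B }.

Lemma plane_isometry_eq (R : realType) (S T : plane_isometry R) : S =1 T -> S = T.
Proof.
case: S T => [f f' fK f'K fd] [g g' gK g'K gd] /= /funext efg.
move: gK g'K gd; rewrite -efg => gK g'K gd.
have efg' : f' = g' by apply/funext => z; rewrite -{1}[z]g'K fK.
move: gK g'K; rewrite -efg' => gK g'K.
by congr Isometry; apply: Prop_irrelevance.
Qed.

Section IsometryGroup.
Variable R : realType.
Implicit Types S T U : plane_isometry R.

Definition iso_id : plane_isometry R :=
  @Isometry R id id (fun=> erefl) (fun=> erefl) (fun _ _ => erefl).

Lemma iso_comp_dist S T A B : edist ((S \o T) A) ((S \o T) B) = edist A B.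
Proof. by rewrite /= !iso_dist. Qed.

Definition iso_comp S T : plane_isometry R :=
  Isometry (can_comp (@iso_funK R S) (@iso_funK R T))
           (can_comp (@iso_invK R T) (@iso_invK R S)) (iso_comp_dist S T).

Lemma iso_inv_dist T A B : edist (iso_inv T A) (iso_inv T B) = edist A B.
Proof. by rewrite -(iso_dist T) !iso_invK. Qed.

Definition iso_sym T : plane_isometry R :=
  Isometry (@iso_invK R T) (@iso_funK R T) (iso_inv_dist T).

HB.instance Definition _ := gen_eqMixin (plane_isometry R).
HB.instance Definition _ := gen_choiceMixin (plane_isometry R).

Fact iso_compA : associative iso_comp.
Proof. by move=> S T U; apply: plane_isometry_eq. Qed.
Fact iso_comp1l : left_id iso_id iso_comp.
Proof. by move=> T; apply: plane_isometry_eq. Qed.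
Fact iso_comp1r : right_id iso_id iso_comp.
Proof. by move=> T; apply: plane_isometry_eq. Qed.
Fact iso_compVl : left_inverse iso_id iso_sym iso_comp.
Proof. by move=> T; apply: plane_isometry_eq => z; apply: iso_funK. Qed.
Fact iso_compVr : right_inverse iso_id iso_sym iso_comp.
Proof. by move=> T; apply: plane_isometry_eq => z; apply: iso_invK. Qed.

HB.instance Definition _ := isGroup.Build (plane_isometry R)
  iso_compA iso_comp1l iso_comp1r iso_compVl iso_compVr.

End IsometryGroup.

Definition S4E2 (R : realType) : Type := ('S_4 * plane_isometry R)%type.

(* (sigma, S) (tau, T) = (sigma \o tau, S \o T).  The library product of
   permutations composes from left to right, (tau * sigma) x = sigma (tau x),
   hence the order of the factors in the first component. *)
Definition S4E2_mul (R : realType) (g h : S4E2 R) : S4E2 R :=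
  ((h.1 * g.1)%g, (g.2 * h.2)%g).

Definition finadd_probability (R : realType) (T : Type) (mu : set T -> R) :=
  [/\ forall E, 0 <= mu E,
      mu setT = 1 &
      forall E F, E `&` F = set0 -> mu (E `|` F) = mu E + mu F].

Definition left_invariant (R : realType) (mu : set (S4E2 R) -> R) :=
  forall (g : S4E2 R) (E : set (S4E2 R)), mu (S4E2_mul g @` E) = mu E.

Definition proper_4colouring (R : realType) (c : R[i] -> 'I_4) :=
  forall A B : R[i], edist A B = 1 -> c A <> c B.

Definition moved_colouring (R : realType) (c0 : R[i] -> 'I_4) (g : S4E2 R) :
    R[i] -> 'I_4 :=
  fun A => g.1 (c0 ((g.2^-1)%g A)).

(* For a left-invariant [mu] this depends only on the distance d of A and B;
   it is then p_d. *)
Definition mono_prob (R : realType) (mu : set (S4E2 R) -> R)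
    (c0 : R[i] -> 'I_4) (A B : R[i]) : R :=
  mu [set g | moved_colouring c0 g A = moved_colouring c0 g B].

(* Main.v *)
Require Import Defs.
From HB Require Import structures.
From mathcomp Require Import all_boot all_order all_algebra all_fingroup.
From mathcomp Require Import all_classical reals.
From mathcomp Require Import complex.
From mathcomp Require Import ring lra.

Set Implicit Arguments.
Unset Strict Implicit.
Unset Printing Implicit Defensive.

Import Order.TTheory GRing.Theory Num.Theory.
Local Open Scope classical_set_scope.
Local Open Scope ring_scope.

(** Write p_s for the probability at distance s and delta_s = 1 - 2 p_s.

    If X, Y are at distance 1 from each other and at distance s from C, at most
    one of them shares the colour of C, and none does with probability delta_s.
    In particular p_s <= 1/2 for s >= 1/2.

    Suppose that delta_s is small.  Join five points X0, ..., X4 by a zigzag of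
    edges of length s, such that the ends of two consecutive edges have unit
    distances to a common point at distance s from the middle vertex.  Then
    with probability about 1/2 all edges are monochromatic, and otherwise none
    is.  In the second case two nonadjacent Xi share a colour by the pigeonhole
    principle, so some other pair is monochromatic with probability above 1/2.
    Quantitatively, 31 p_s <= 12 + 6 M as soon as M bounds p at the six other
    distances.  With M = 1/2 this gives p_s <= 15/31, and with M the supremum
    of p over [b, oo), for a suitable b, it gives p_s <= 12/25.

    On a unit circle only the three colours other than that of the centre occur.
    For the four points 1, zeta, w, zeta w with zeta = exp(i pi / 3) and
    |1 - w| = d, this forces p_s + p_s' + 2 p_d >= 1, where s and s' are the
    distances |zeta - w| and |1 - zeta w|; the upper bounds on p_s and p_s'
    then give the lower bounds on p_d. *)

(** * Finitely additive probability measures *)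

Section FinitelyAdditive.
Context (R : realType) (T : Type) (mu : set T -> R).
Hypothesis mu_prob : finadd_probability mu.

Lemma finadd_ge0 E : 0 <= mu E.
Proof. by have [h _ _] := mu_prob. Qed.

Lemma finadd_setT : mu setT = 1.
Proof. by have [_ h _] := mu_prob. Qed.

Lemma finaddU E F : E `&` F = set0 -> mu (E `|` F) = mu E + mu F.
Proof. by have [_ _ h] := mu_prob; apply: h. Qed.

Lemma finadd_splitD E F : mu E = mu (E `&` F) + mu (E `\` F).
Proof.
rewrite -finaddU; first by rewrite setUIDK.
by rewrite setDE setIACA setICr setI0.
Qed.

Lemma finadd_mono E F : E `<=` F -> mu E <= mu F.
Proof.
by move=> /setIidr EF; rewrite (finadd_splitD F E) EF lerDl finadd_ge0.
Qed.

Lemma finadd_cover E F G : E `<=` F `|` G -> mu E <= mu F + mu G.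
Proof.
move=> EFG; rewrite (finadd_splitD E F) lerD //; apply: finadd_mono.
  exact: subIsetr.
by move=> x [/EFG[]].
Qed.

Lemma finadd_cover_le E F G r : mu G <= r -> E `<=` F `|` G -> mu E <= mu F + r.
Proof.
by move=> Gr /finadd_cover/le_trans; apply; rewrite lerD2l.
Qed.

Lemma finaddU_le F G a b : mu F <= a -> mu G <= b -> mu (F `|` G) <= a + b.
Proof. by move=> Fa Gb; apply: le_trans (lerD Fa Gb); apply: finadd_cover. Qed.

End FinitelyAdditive.

Lemma not_uniq5_ord4 (a b c d e : 'I_4) : ~~ uniq [:: a; b; c; d; e].
Proof.
apply/negP => /card_uniqP; apply/eqP; rewrite neq_ltn /=.
by rewrite (leq_ltn_trans (max_card _)) // card_ord.
Qed.

(** * Distances in coordinates and isometries of the plane *)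

Lemma sqrtr_uniq (R : realType) (x y : R) :
  0 <= y -> y ^+ 2 = x -> Num.sqrt x = y.
Proof. by move=> y0 <-; rewrite sqrtr_sqr ger0_norm. Qed.

Lemma edistE (R : realType) (x y x' y' : R) :
  edist (Complex x y) (Complex x' y') = Num.sqrt ((x - x') ^+ 2 + (y - y') ^+ 2).
Proof. by []. Qed.

Lemma edist_eqP (R : realType) (x y x' y' d : R) : 0 <= d ->
  (x - x') ^+ 2 + (y - y') ^+ 2 = d ^+ 2 ->
  edist (Complex x y) (Complex x' y') = d.
Proof. by move=> d0 e; rewrite edistE e sqrtr_sqr ger0_norm. Qed.

Lemma edist_geP (R : realType) (x y x' y' d : R) : 0 <= d ->
  d ^+ 2 <= (x - x') ^+ 2 + (y - y') ^+ 2 ->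
  d <= edist (Complex x y) (Complex x' y').
Proof. by move=> d0 e; rewrite edistE -[d]ger0_norm // -sqrtr_sqr ler_wsqrtr. Qed.

Lemma edist_ge0 (R : realType) (A B : R[i]) : 0 <= edist A B.
Proof. by rewrite /edist; case: (A - B) => x y; apply: sqrtr_ge0. Qed.

Lemma edistC (R : realType) (A B : R[i]) : edist A B = edist B A.
Proof.
case: A B => [x y] [x' y'].
by rewrite !edistE -[x - x']opprB -[y - y']opprB !sqrrN.
Qed.

Lemma edist_eq0 (R : realType) (A B : R[i]) : edist A B = 0 -> A = B.
Proof. by move=> /ComplexField.Normc.eq0_normc /eqP; rewrite subr_eq0 => /eqP. Qed.

Lemma edistxx (R : realType) (A : R[i]) : edist A A = 0.
Proof. by rewrite /edist subrr ComplexField.Normc.normc0. Qed.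

Lemma affine_edist (R : realType) (u v : R[i]) :
  ComplexField.Normc.normc u = 1 ->
  forall z w, edist (u * z + v) (u * w + v) = edist z w.
Proof.
move=> u1 z w; rewrite /edist opprD addrACA subrr addr0 -mulrBr.
by rewrite ComplexField.Normc.normcM u1 mul1r.
Qed.

(** The map z -> u z + v works with u = (A' - B') / (A - B), which has modulus 1. If A = B, a
    translation suffices. *)
Lemma isometry_exists (R : realType) (A B A' B' : R[i]) :
  edist A B = edist A' B' ->
  exists T : plane_isometry R, T A = A' /\ T B = B'.
Proof.
move=> AB.
have [u [u1 uAB]] : exists u : R[i],
    ComplexField.Normc.normc u = 1 /\ u * (A - B) = A' - B'.
  have [AB0|AB0] := eqVneq A B.
    exists 1; rewrite ComplexField.Normc.normc1; split=> //.
    have -> : A' = B' by apply: edist_eq0; rewrite -AB AB0 edistxx.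
    by rewrite AB0 !subrr mulr0.
  have D0 : A - B != 0 by rewrite subr_eq0.
  exists ((A' - B') / (A - B)); split; last by rewrite divfK.
  rewrite ComplexField.Normc.normcM ComplexField.Normc.normcV.
  move: (AB); rewrite /edist => ->; rewrite divff //.
  apply: contra_neq AB0 => h; apply: edist_eq0.
  by rewrite AB /edist h.
have u0 : u != 0.
  by apply: contra_eq_neq u1 => ->; rewrite ComplexField.Normc.normc0 eq_sym oner_eq0.
pose v := A' - u * A.
have fK : cancel (fun z => u * z + v) (fun z => u^-1 * (z - v)).
  by move=> z; rewrite addrK mulKf.
have gK : cancel (fun z => u^-1 * (z - v)) (fun z => u * z + v).
  by move=> z; rewrite mulVKf // subrK.
exists (Isometry fK gK (affine_edist v u1)); split=> /=.
  by rewrite /v addrC subrK.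
by rewrite /v addrCA -mulrBr -opprB mulrN uAB opprB addrC subrK.
Qed.

(** * Monochromaticity probabilities as a function of the distance *)

Section Colouring.
Context (R : realType) (c0 : R[i] -> 'I_4) (mu : set (S4E2 R) -> R).
Hypothesis c0_proper : proper_4colouring c0.
Hypothesis mu_prob : finadd_probability mu.
Hypothesis mu_inv : left_invariant mu.

Local Notation col := (moved_colouring c0).
Local Notation same A B := [set g | col g A = col g B].
Local Notation p := (mono_prob mu c0).

Lemma moved_proper g : proper_4colouring (col g).
Proof.
move=> A B AB /perm_inj; apply: c0_proper.
by rewrite -AB; apply: (iso_inv_dist g.2).
Qed.

(** Left translation by (1, T) carries the event for the pair A, B onto the event for T A, T B. *)
Lemma mono_prob_edist A B A' B' : edist A B = edist A' B' -> p A B = p A' B'.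
Proof.
move=> /isometry_exists[T [<- <-]].
rewrite /mono_prob -(mu_inv ((1%g : 'S_4), T)); congr mu.
apply/seteqP; split=> g /=.
  move=> [[s S] /= h <-]; move: h.
  by rewrite /moved_colouring /= mulg1 /= !iso_funK.
move=> h; exists (g.1, (T^-1 * g.2)%g).
  exact: h.
by rewrite /S4E2_mul /= mulg1 mulKVg; case: g {h}.
Qed.

(** This is p_d for d >= 0, read off from one standard pair; a negative d stands for the distance
    |d|. *)
Definition p_at (d : R) : R := p 0 (Complex d 0).

Lemma p_atE A B : p A B = p_at (edist A B).
Proof.
apply: mono_prob_edist; apply/esym.
by apply: (@edist_eqP _ 0 0); [exact: edist_ge0 | ring].
Qed.

Lemma p_at_same A B d : edist A B = d -> mu (same A B) = p_at d.
Proof. by move=> <-; rewrite -p_atE. Qed.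

(** * Inequalities from finite configurations of points *)

Lemma isosceles_mono X C Y s : edist C X = s -> edist C Y = s ->
  edist X Y = 1 -> mu [set g | col g C <> col g X /\ col g C <> col g Y] =
  1 - 2 * p_at s.
Proof.
move=> CX CY XY.
have disj : same C X `&` same C Y = set0.
  apply/seteqP; split=> g //= [h1 h2].
  by apply: (moved_proper (g := g) XY); rewrite -h1 -h2.
have := finadd_setT mu_prob.
rewrite (finadd_splitD mu_prob setT (same C X `|` same C Y)) setTI finaddU //.
rewrite (p_at_same CX) (p_at_same CY) setTD => e.
suff <- : ~` (same C X `|` same C Y) =
  [set g | col g C <> col g X /\ col g C <> col g Y] by lra.
by apply/seteqP; split=> g /=; tauto.
Qed.

Lemma p_at_le_half X C Y s : edist C X = s -> edist C Y = s ->
  edist X Y = 1 -> p_at s <= 1 / 2.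
Proof.
move=> CX CY XY; have := isosceles_mono CX CY XY.
have := finadd_ge0 mu_prob [set g | col g C <> col g X /\ col g C <> col g Y].
lra.
Qed.

(** If X has the colour of C, then B, at unit distance from X, does not. So neither Y nor B has the
    colour of C, and [isosceles_mono] applies to the pair Y, B. *)
Lemma turn_bound X C Y B s : edist C X = s -> edist C Y = s -> edist C B = s ->
  edist X B = 1 -> edist Y B = 1 ->
  mu [set g | col g X = col g C /\ col g C <> col g Y] <= 1 - 2 * p_at s.
Proof.
move=> CX CY CB XB YB; rewrite -(isosceles_mono CY CB YB).
apply: finadd_mono => // g /= [h1 h2]; split=> // h3.
by apply: (moved_proper (g := g) XB); rewrite h1.
Qed.

(** Among O and the four points some colour repeats. The unit distances rule out all pairs except
    the four on the right. *)
Lemma square_bound O W0 W1 W2 W3 :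
  edist O W0 = 1 -> edist O W1 = 1 -> edist O W2 = 1 -> edist O W3 = 1 ->
  edist W0 W1 = 1 -> edist W2 W3 = 1 ->
  1 <= p W1 W2 + p W0 W3 + (p W0 W2 + p W1 W3).
Proof.
move=> O0 O1 O2 O3 d01 d23; rewrite -(finadd_setT mu_prob).
apply: (@le_trans _ _ (mu (same W1 W2 `|` same W0 W3) +
                       mu (same W0 W2 `|` same W1 W3))); last first.
  by apply: lerD; apply: finadd_cover.
apply: finadd_cover => // g _ /=.
have := not_uniq5_ord4 (col g O) (col g W0) (col g W1) (col g W2) (col g W3).
rewrite /= !inE !negb_and !negbK.
have /eqP/negPf -> := moved_proper (g := g) O0.
have /eqP/negPf -> := moved_proper (g := g) O1.
have /eqP/negPf -> := moved_proper (g := g) O2.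
have /eqP/negPf -> := moved_proper (g := g) O3.
have /eqP/negPf -> := moved_proper (g := g) d01.
have /eqP/negPf -> := moved_proper (g := g) d23.
rewrite /= orbF.
by case/orP=> [/orP[]/eqP|/orP[]/eqP]; tauto.
Qed.

Lemma zigzag_bound X0 X1 X2 X3 X4 B1 B2 B3 s M :
  edist X0 X1 = s -> edist X1 X2 = s -> edist X2 X3 = s -> edist X3 X4 = s ->
  edist X1 B1 = s -> edist X2 B2 = s -> edist X3 B3 = s ->
  edist X0 B1 = 1 -> edist X2 B1 = 1 -> edist X1 B2 = 1 -> edist X3 B2 = 1 ->
  edist X2 B3 = 1 -> edist X4 B3 = 1 ->
  p X0 X2 <= M -> p X1 X3 <= M -> p X2 X4 <= M ->
  p X0 X3 <= M -> p X1 X4 <= M -> p X0 X4 <= M ->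
  31 * p_at s <= 12 + 6 * M.
Proof.
move=> d01 d12 d23 d34 b1 b2 b3 u01 u21 u12 u32 u23 u43 m02 m13 m24 m03 m14 m04.
have dC (A B : R[i]) r : edist A B = r -> edist B A = r by move=> <-; rewrite edistC.
have t012 := turn_bound (dC _ _ _ d01) d12 b1 u01 u21.
have t123 := turn_bound (dC _ _ _ d12) d23 b2 u12 u32.
have t234 := turn_bound (dC _ _ _ d23) d34 b3 u23 u43.
have t210 := turn_bound d12 (dC _ _ _ d01) b1 u21 u01.
have t321 := turn_bound d23 (dC _ _ _ d12) b2 u32 u12.
have t432 := turn_bound d34 (dC _ _ _ d23) b3 u43 u23.
have s01 := p_at_same d01; have s12 := p_at_same d12; have s23 := p_at_same d23.
have gap X Y (Q : set (S4E2 R)) : p X Y <= M -> Q `<=` same X Y ->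
    mu (same X Y `\` Q) <= M - mu Q.
  move=> pM /setIidr QXY; move: pM; rewrite /mono_prob.
  by rewrite (finadd_splitD mu_prob (same X Y) Q) QXY; lra.
(* qij: all edges between Xi and Xj are monochromatic. *)
pose q02 : set (S4E2 R) := [set g | col g X0 = col g X1 /\ col g X1 = col g X2].
pose q13 : set (S4E2 R) := [set g | col g X1 = col g X2 /\ col g X2 = col g X3].
pose q24 : set (S4E2 R) := [set g | col g X2 = col g X3 /\ col g X3 = col g X4].
pose q03 := q02 `&` q13; pose q14 := q13 `&` q24; pose q04 := q03 `&` q24.
(* Extending a monochromatic run by one edge loses at most 1 - 2 p_s by [turn_bound]. Hence runs of
   2, 3 and 4 edges have probability at least 3 p_s - 1, 5 p_s - 2 and 7 p_s - 3. *)
have q02_ge : p_at s <= mu q02 + (1 - 2 * p_at s).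
  rewrite -{1}s01; apply: (finadd_cover_le mu_prob t012) => g /=.
  by rewrite /q02 /=; case: (pselect (col g X1 = col g X2)); tauto.
have q13_ge : p_at s <= mu q13 + (1 - 2 * p_at s).
  rewrite -{1}s12; apply: (finadd_cover_le mu_prob t123) => g /=.
  by rewrite /q13 /=; case: (pselect (col g X2 = col g X3)); tauto.
have q24_ge : p_at s <= mu q24 + (1 - 2 * p_at s).
  rewrite -{1}s23; apply: (finadd_cover_le mu_prob t234) => g /=.
  by rewrite /q24 /=; case: (pselect (col g X3 = col g X4)); tauto.
have q03_ge : mu q02 <= mu q03 + (1 - 2 * p_at s).
  apply: (finadd_cover_le mu_prob t123) => g /=.
  by rewrite /q03 /q02 /q13 /=; case: (pselect (col g X2 = col g X3)); tauto.
have q14_ge : mu q13 <= mu q14 + (1 - 2 * p_at s).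
  apply: (finadd_cover_le mu_prob t234) => g /=.
  by rewrite /q14 /q13 /q24 /=; case: (pselect (col g X3 = col g X4)); tauto.
have q04_ge : mu q03 <= mu q04 + (1 - 2 * p_at s).
  apply: (finadd_cover_le mu_prob t234) => g /=.
  by rewrite /q04 /q03 /q13 /q24 /=; case: (pselect (col g X3 = col g X4)); tauto.
have g02 : mu (same X0 X2 `\` q02) <= M - mu q02 by apply: gap => // g [/= -> ->].
have g13 : mu (same X1 X3 `\` q13) <= M - mu q13 by apply: gap => // g [/= -> ->].
have g24 : mu (same X2 X4 `\` q24) <= M - mu q24 by apply: gap => // g [/= -> ->].
have g03 : mu (same X0 X3 `\` q03) <= M - mu q03.
  by apply: gap => // g [[/= -> ->] [_ ->]].
have g14 : mu (same X1 X4 `\` q14) <= M - mu q14.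
  by apply: gap => // g [[/= -> ->] [_ ->]].
have g04 : mu (same X0 X4 `\` q04) <= M - mu q04.
  by apply: gap => // g [[[/= -> ->] [_ ->]] [_ ->]].
(* If some edge is monochromatic, the first such edge is X0 X1 or follows a non-monochromatic one,
   which is [adj]. If none is, the pigeonhole principle gives [far]. Summing up, 1 <= p_s + 3 (1 - 2
   p_s) + 6 M - 3 (3 p_s - 1) - 2 (5 p_s - 2) - (7 p_s - 3). *)
pose adj := [set g | col g X2 = col g X1 /\ col g X1 <> col g X0] `|`
  ([set g | col g X3 = col g X2 /\ col g X2 <> col g X1] `|`
   [set g | col g X4 = col g X3 /\ col g X3 <> col g X2]).
pose far := same X0 X2 `\` q02 `|` (same X1 X3 `\` q13 `|` (same X2 X4 `\` q24 `|`
  (same X0 X3 `\` q03 `|` (same X1 X4 `\` q14 `|` same X0 X4 `\` q04)))).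
have adj_le := finaddU_le mu_prob t210 (finaddU_le mu_prob t321 t432).
have far_le := finaddU_le mu_prob g02 (finaddU_le mu_prob g13
  (finaddU_le mu_prob g24 (finaddU_le mu_prob g03 (finaddU_le mu_prob g14 g04)))).
have : mu setT <= mu (same X0 X1 `|` adj) + mu far.
  apply: finadd_cover => // g _.
  have := not_uniq5_ord4 (col g X0) (col g X1) (col g X2) (col g X3) (col g X4).
  rewrite /adj /far /q04 /q14 /q03 /q24 /q13 /q02 /= !inE !negb_and !negbK !orbF.
  case: (pselect (col g X0 = col g X1)) => [|n01]; first by tauto.
  case: (pselect (col g X1 = col g X2)) => [e12 _|n12].
    by left; right; left; split=> [|/esym].
  case: (pselect (col g X2 = col g X3)) => [e23 _|n23].
    by left; right; right; left; split=> [|/esym].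
  case: (pselect (col g X3 = col g X4)) => [e34 _|n34].
    by left; right; right; right; split=> [|/esym].
  rewrite -!orbA.
  do 9!(case/orP=> [/eqP|]; first by tauto).
  by move=> /eqP; tauto.
have := finaddU_le mu_prob (lexx _ : mu (same X0 X1) <= _) adj_le.
rewrite (finadd_setT mu_prob) s01 -/far -/adj in far_le *.
lra.
Qed.


(** * Upper bounds on p from an explicit zigzag *)

Lemma zigzag_step s b M : 1 / 2 <= s -> 0 <= b -> b <= s ->
  b ^+ 2 * s ^+ 2 + 1 <= 4 * s ^+ 2 -> (forall t, b <= t -> p_at t <= M) ->
  31 * p_at s <= 12 + 6 * M.
Proof.
move=> s_ge b_ge0 bs bss pM.
have s_gt0 : 0 < s by lra.
(* Here r^2 + k^2 = 1 and 2 k s = 1, so that (r, k) and (0, 0), (2 r, 0) are at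
   unit distance and (r, k - s) is at distance s from all three. *)
pose k := (2 * s)^-1; pose r := Num.sqrt (1 - k ^+ 2).
have ks : 2 * (k * s) = 1 by rewrite /k; field; lra.
have r_ge0 : 0 <= r by apply: sqrtr_ge0.
have r2 : r ^+ 2 = 1 - k ^+ 2.
  rewrite sqr_sqrtr // subr_ge0 expr_le1 ?invr_ge0 //; last lra.
  by rewrite invf_le1; lra.
(* The smallest distance between nonadjacent vertices is 2 r, with 4 r^2 = 4 - 1 / s^2; the
   hypothesis relating b and s says exactly that b <= 2 r. *)
have b2r : b ^+ 2 <= 4 * r ^+ 2.
  rewrite -(ler_pM2r (exprn_gt0 2 s_gt0)) r2.
  by have -> : 4 * (1 - k ^+ 2) * s ^+ 2 = 4 * s ^+ 2 - (2 * (k * s)) ^+ 2;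
    [ring | rewrite ks; lra].
have b2s : b ^+ 2 <= s ^+ 2 by rewrite ler_pXn2r // ?nnegrE; lra.
have far x y x' y' : b ^+ 2 <= (x - x') ^+ 2 + (y - y') ^+ 2 ->
    p (Complex x y) (Complex x' y') <= M.
  by move=> h; rewrite p_atE; apply: pM; apply: edist_geP.
have s_ge0 : 0 <= s by lra.
have r2_ge0 := sqr_ge0 r.
apply: (@zigzag_bound (Complex 0 0) (Complex r (k - s)) (Complex (2 * r) 0)
  (Complex (3 * r) (k - s)) (Complex (4 * r) 0) (Complex r k)
  (Complex (2 * r) (- s)) (Complex (3 * r) k));
  (apply: edist_eqP => // || apply: far); lra.
Qed.

Lemma p_at_half s : 1 / 2 <= s -> p_at s <= 1 / 2.
Proof.
move=> s_ge.
have s_ge0 : 0 <= s by lra.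
pose h := Num.sqrt (s ^+ 2 - (1 / 2) ^+ 2).
have h2 : h ^+ 2 = s ^+ 2 - (1 / 2) ^+ 2.
  by rewrite sqr_sqrtr // subr_ge0 ler_pXn2r // ?nnegrE; lra.
apply: (@p_at_le_half (Complex (1 / 2) 0) (Complex 0 h) (Complex (- (1 / 2)) 0));
  by apply: edist_eqP => //; lra.
Qed.

(** For b = 1 / 2 the condition b^2 s^2 + 1 <= 4 s^2 of [zigzag_step] reads 4 / 15 <= s^2. *)
Lemma p_at_15_31 s : 4 / 15 <= s ^+ 2 -> 1 / 2 <= s -> p_at s <= 15 / 31.
Proof.
move=> s2 s_ge.
have := @zigzag_step s (1 / 2) (1 / 2) s_ge _ s_ge _ p_at_half.
by move=> h; have := h ltac:(lra) ltac:(lra); lra.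
Qed.

(* The supremum M of p_at on [b, oo) satisfies 31 M <= 12 + 6 M. *)
Lemma p_at_12_25 b s : 1 / 2 <= b -> b <= 1 -> 1 <= b ^+ 2 * (4 - b ^+ 2) ->
  b <= s -> p_at s <= 12 / 25.
Proof.
move=> b_ge b_le b2 bs.
pose E := [set p_at t | t in [set t | b <= t]].
have E0 : E !=set0 by exists (p_at s), s.
have E_ub : has_ubound E.
  by exists (1 / 2) => _ [t /= bt <-]; apply: p_at_half; lra.
have E_sup t : b <= t -> p_at t <= sup E.
  by move=> bt; apply: ub_le_sup => //; exists t.
suff : sup E <= (12 + 6 * sup E) / 31 by have := E_sup _ bs; lra.
apply: ge_sup => // _ [t /= bt <-].
have bt2 : b ^+ 2 <= t ^+ 2 by rewrite ler_pXn2r // ?nnegrE; lra.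
suff : 31 * p_at t <= 12 + 6 * sup E by lra.
apply: (@zigzag_step t b) => //; [lra | lra | ].
have b1 : b ^+ 2 <= 1 by rewrite expr_le1 //; lra.
(* The hypothesis on b is the condition of [zigzag_step] at t = b; it persists for t >= b because
   t^2 (4 - b^2) increases with t. *)
have := ler_wpM2r (_ : 0 <= 4 - b ^+ 2) bt2.
by move=> /(_ ltac:(lra)); lra.
Qed.

(** * Lower bounds on p from four points on a unit circle *)

Lemma square_ineq d s s' : 0 <= d -> d <= 2 ->
  0 <= s -> 0 <= s' -> 
  s ^+ 2 = 1 + d ^+ 2 / 2 - Num.sqrt 3 * d * Num.sqrt (1 - d ^+ 2 / 4) ->
  s' ^+ 2 = 1 + d ^+ 2 / 2 + Num.sqrt 3 * d * Num.sqrt (1 - d ^+ 2 / 4) ->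
  1 <= p_at s + p_at s' + 2 * p_at d.
Proof.
move=> d_ge0 d_le2 s_ge0 s'_ge0.
set e := Num.sqrt (1 - _); set q := Num.sqrt 3 => s2 s2'.
have e2 : e ^+ 2 = 1 - d ^+ 2 / 4.
  rewrite sqr_sqrtr //.
  have : d ^+ 2 <= 2 ^+ 2 by rewrite ler_pXn2r // ?nnegrE; lra.
  lra.
have q2 : q ^+ 2 = 3 by rewrite sqr_sqrtr //; lra.
(* With w = exp(i theta) and |1 - w| = d, these are cos theta and sin theta. Then s^2 and s'^2 are 2
   - 2 cos(theta - pi / 3) and 2 - 2 cos(theta + pi / 3). *)
pose c := 1 - d ^+ 2 / 2; pose t := d * e.
have ct : c ^+ 2 + t ^+ 2 = 1 by rewrite exprMn e2 /c; field.
have c2 : c ^+ 2 = 1 - t ^+ 2 by lra.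
have d2 : d ^+ 2 = 2 - 2 * c by rewrite /c; field.
have {}s2 : s ^+ 2 = 2 - c - q * t by rewrite s2 /t /c; field.
have {}s2' : s' ^+ 2 = 2 - c + q * t by rewrite s2' /t /c; field.
have n3 : (c / 2 - q / 2 * t) ^+ 2 + (q / 2 * c + t / 2) ^+ 2 = 1.
  rewrite [LHS](_ : _ = (1 + q ^+ 2) / 4 * (c ^+ 2 + t ^+ 2)); last by field.
  by rewrite q2 ct; field.
have n23 : (c / 2 + q / 2 * t) ^+ 2 + (t / 2 - q / 2 * c) ^+ 2 = 1.
  rewrite [LHS](_ : _ = (1 + q ^+ 2) / 4 * (c ^+ 2 + t ^+ 2)); last by field.
  by rewrite q2 ct; field.
have n13 : (1 / 2 - (c / 2 - q / 2 * t)) ^+ 2 + (q / 2 - (q / 2 * c + t / 2)) ^+ 2 =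
    d ^+ 2.
  rewrite [LHS](_ : _ = (1 + q ^+ 2) / 4 * ((1 - c) ^+ 2 + t ^+ 2)); last by field.
  by rewrite q2 d2 sqrrB c2; field.
pose W0 : R[i] := Complex 1 0; pose W1 : R[i] := Complex (1 / 2) (q / 2).
pose W2 : R[i] := Complex c t.
pose W3 : R[i] := Complex (c / 2 - q / 2 * t) (q / 2 * c + t / 2).
have e12 : edist W1 W2 = s by apply: edist_eqP; lra.
have e03 : edist W0 W3 = s' by apply: edist_eqP; lra.
have e02 : edist W0 W2 = d by apply: edist_eqP; lra.
have e13 : edist W1 W3 = d by apply: edist_eqP; lra.
have := @square_bound (Complex 0 0) W0 W1 W2 W3.
rewrite !p_atE e12 e03 e02 e13 => square.
suff : 1 <= p_at s + p_at s' + (p_at d + p_at d) by lra.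
by apply: square; apply: edist_eqP; lra.
Qed.

(** In [square_ineq] one has s = |e - sqrt 3 d / 2| and s' = e + sqrt 3 d / 2 with e = sqrt (1 - d^2
    / 4). Always s' >= 1, so p_s' <= 12 / 25, and the disjunction ensures s >= m, so p_s <= u. *)
Lemma p_at_ge d m u : 0 <= d -> d <= 2 -> 0 <= m -> m <= 1 ->
  d + Num.sqrt 3 / 2 * m <= Num.sqrt (1 - m ^+ 2 / 4) \/
  Num.sqrt (1 - m ^+ 2 / 4) + Num.sqrt 3 / 2 * m <= d ->
  (forall s, m <= s -> p_at s <= u) ->
  (13 / 25 - u) / 2 <= p_at d.
Proof.
move=> d_ge0 d_le2 m_ge0 m_le1; set q := Num.sqrt 3; set w := Num.sqrt _.
pose e := Num.sqrt (1 - d ^+ 2 / 4) => dm pu.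
have q_ge0 : 0 <= q by apply: sqrtr_ge0.
have q2 : q ^+ 2 = 3 by rewrite sqr_sqrtr //; lra.
have e_ge0 : 0 <= e by apply: sqrtr_ge0.
have e2 : e ^+ 2 = 1 - d ^+ 2 / 4.
  rewrite sqr_sqrtr //.
  have : d ^+ 2 <= 2 ^+ 2 by rewrite ler_pXn2r // ?nnegrE; lra.
  lra.
have m2 : m ^+ 2 <= 1 by rewrite expr_le1.
have w_ge0 : 0 <= w by apply: sqrtr_ge0.
have w2 : w ^+ 2 = 1 - m ^+ 2 / 4 by rewrite sqr_sqrtr //; lra.
have qd_ge0 : 0 <= q * d by apply: mulr_ge0.
have qm_ge0 : 0 <= q * m by apply: mulr_ge0.
have qe : (q * d / 2) ^+ 2 = 3 * d ^+ 2 / 4.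
  by rewrite -q2; field.
have qm : (q / 2 * m) ^+ 2 = 3 * m ^+ 2 / 4.
  by rewrite -q2; field.
have s_ge : m <= `|e - q * d / 2|.
  case: dm => dm.
    (* Squared, this says d^2 + sqrt 3 d m + m^2 <= 1. By symmetry d and m can be interchanged,
       which gives m + sqrt 3 d / 2 <= e. The other case is similar, with the sign of the mixed term
       and the inequality reversed. *)
    have : (d + q / 2 * m) ^+ 2 <= w ^+ 2 by rewrite ler_pXn2r // ?nnegrE; lra.
    rewrite w2 sqrrD qm => dm2.
    have : (m + q * d / 2) ^+ 2 <= e ^+ 2 by rewrite e2 sqrrD qe; lra.
    rewrite ler_pXn2r // ?nnegrE; last lra.
    by move=> h; apply: le_trans (ler_norm _); lra.
  have : w ^+ 2 <= (d - q / 2 * m) ^+ 2 by rewrite ler_pXn2r // ?nnegrE; lra.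
  rewrite w2 sqrrB qm => dm2.
  have wq : q / 2 <= w.
    rewrite -(@ler_pXn2r _ 2%N) // ?nnegrE; last lra.
    by rewrite w2 exprMn q2; lra.
  (* This sign is needed to take square roots below; it follows from sqrt 3 d / 2 >= 3 / 4 + 3 m / 4
     and m <= 1. *)
  have qd_ge : m <= q * d / 2.
    have := ler_wpM2l q_ge0 dm; have := ler_wpM2l q_ge0 wq.
    have -> : q * (w + q / 2 * m) = q * w + q ^+ 2 / 2 * m by field.
    have -> : q * (q / 2) = q ^+ 2 / 2 by field.
    by rewrite q2; lra.
  have : e ^+ 2 <= (q * d / 2 - m) ^+ 2 by rewrite e2 sqrrB qe; lra.
  rewrite ler_pXn2r // ?nnegrE; last lra.
  by move=> h; rewrite distrC; apply: le_trans (ler_norm _); lra.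
have s'_ge : 1 <= e + q * d / 2.
  rewrite -(@ler_pXn2r _ 2%N) // ?nnegrE; [| lra ..].
  have := mulr_ge0 e_ge0 qd_ge0.
  by rewrite sqrrD qe e2 expr1n; have := sqr_ge0 d; lra.
have := pu _ s_ge.
have := @p_at_12_25 1 (e + q * d / 2) _ _ _ s'_ge.
have := @square_ineq d `|e - q * d / 2| (e + q * d / 2) d_ge0 d_le2 (normr_ge0 _) _ _ _.
rewrite -/q -/e real_normK ?num_real // sqrrB sqrrD qe e2.
move=> h1 h2.
have := h1 ltac:(lra) ltac:(lra) ltac:(lra).
have := h2 ltac:(lra) ltac:(lra) ltac:(lra).
lra.
Qed.

End Colouring.

(** * The six ranges of d *)

Theorem mainTheorem5 (R : realType) (c0 : R[i] -> 'I_4)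
    (mu : set (S4E2 R) -> R)
    (c0_proper : proper_4colouring c0)
    (mu_prob : finadd_probability mu)
    (mu_inv : left_invariant mu)
    (d : R) (d_ge0 : 0 <= d)
    (A B : R[i]) (dAB : edist A B = d) :
  let p_d := mono_prob mu c0 A B in
  (d <= (Num.sqrt 6 - Num.sqrt 2) / 2 -> 1 / 50 <= p_d) /\
  ((Num.sqrt 6 - Num.sqrt 2) / 2 < d ->
   d <= Num.sqrt (14 / 15) - 1 / Num.sqrt 5 -> 14 / 775 <= p_d) /\
  (Num.sqrt (14 / 15) - 1 / Num.sqrt 5 < d ->
   d <= Num.sqrt 15 / 4 - Num.sqrt 3 / 4 -> 1 / 100 <= p_d) /\
  ((Num.sqrt 15 + Num.sqrt 3) / 4 <= d ->
   d < Num.sqrt (14 / 15) + 1 / Num.sqrt 5 -> 1 / 100 <= p_d) /\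
  (Num.sqrt (14 / 15) + 1 / Num.sqrt 5 <= d ->
   d < Num.sqrt 2 -> 14 / 775 <= p_d) /\
  (Num.sqrt 2 <= d -> d < 2 -> 1 / 50 <= p_d).
Proof.
rewrite /= (p_atE c0 mu_inv) dAB.
set a := Num.sqrt 2; set b := Num.sqrt 3; set f := Num.sqrt 5.
have a2 : a ^+ 2 = 2 by rewrite sqr_sqrtr //; lra.
have b2 : b ^+ 2 = 3 by rewrite sqr_sqrtr //; lra.
have f2 : f ^+ 2 = 5 by rewrite sqr_sqrtr //; lra.
have sqr_bounds (x l r : R) : 0 <= x -> 0 <= l -> 0 <= r ->
    l ^+ 2 <= x ^+ 2 -> x ^+ 2 <= r ^+ 2 -> l <= x /\ x <= r.
  by move=> x0 l0 r0; rewrite !ler_pXn2r // nnegrE.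
have [a_ge a_le] : 7 / 5 <= a /\ a <= 3 / 2.
  by apply: sqr_bounds; rewrite ?sqrtr_ge0 ?a2; lra.
have [b_ge b_le] : 17 / 10 <= b /\ b <= 7 / 4.
  by apply: sqr_bounds; rewrite ?sqrtr_ge0 ?b2; lra.
have [f_ge f_le] : 2 <= f /\ f <= 9 / 4.
  by apply: sqr_bounds; rewrite ?sqrtr_ge0 ?f2; lra.
have -> : Num.sqrt 6 = a * b :> R by rewrite -sqrtrM; [congr Num.sqrt; lra | lra].
have -> : Num.sqrt 15 = b * f :> R by rewrite -sqrtrM; [congr Num.sqrt; lra | lra].
have fV : 1 / f = f / 5 by rewrite -f2; field; lra.
rewrite !fV.
(* The three values m0, m1, 1 / 2 of m for which sqrt (1 - m^2 / 4) -+ sqrt 3 / 2 * m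
   are the end points of the intervals for d. *)
pose m0 := (a * b - a) / 2.
have ab_ge : 7 / 5 * b <= a * b by apply: ler_wpM2r; lra.
have ab_le : a * b <= 3 / 2 * b by apply: ler_wpM2r; lra.
have bf_ge : 17 / 10 * f <= b * f by apply: ler_wpM2r; lra.
have bf_le : b * f <= 7 / 4 * f by apply: ler_wpM2r; lra.
have m02 : m0 ^+ 2 = 2 - b.
  rewrite [LHS](_ : _ = a ^+ 2 * (b ^+ 2 - 2 * b + 1) / 4); last by rewrite /m0; field.
  by rewrite a2 b2; field.
have [m0_ge m0_le] : 1 / 2 <= m0 /\ m0 <= 1.
  by apply: sqr_bounds; rewrite ?m02 /m0; lra.
(* Together with [bm0] this makes the end points for m = m0 equal to m0 itself and sqrt 2. *)
have w0 : Num.sqrt (1 - m0 ^+ 2 / 4) = (a * b + a) / 4.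
  apply: sqrtr_uniq; first lra.
  rewrite m02 [LHS](_ : _ = a ^+ 2 * (b ^+ 2 + 2 * b + 1) / 16); last by field.
  by rewrite a2 b2; field.
have bm0 : b / 2 * m0 = (3 * a - a * b) / 4.
  rewrite [LHS](_ : _ = a * (b ^+ 2 - b) / 4); last by rewrite /m0; field.
  by rewrite b2; field.
pose m1 := 2 * (b * f) / 15.
have m12 : m1 ^+ 2 = 4 / 15.
  rewrite [LHS](_ : _ = 4 * b ^+ 2 * f ^+ 2 / 225); last by rewrite /m1; field.
  by rewrite b2 f2; field.
have [m1_ge m1_le] : 1 / 2 <= m1 /\ m1 <= 1.
  by apply: sqr_bounds; rewrite ?m12 /m1; lra.
have bm1 : b / 2 * m1 = f / 5.
  rewrite [LHS](_ : _ = b ^+ 2 * f / 15); last by rewrite /m1; field.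
  by rewrite b2; field.
have w1 : Num.sqrt (1 - m1 ^+ 2 / 4) = Num.sqrt (14 / 15).
  by congr Num.sqrt; rewrite m12; field.
have w2 : Num.sqrt (1 - (1 / 2) ^+ 2 / 4) = b * f / 4 :> R.
  apply: sqrtr_uniq; first lra.
  by rewrite expr_div_n exprMn b2 f2; field.
have w1_ge0 : 0 <= Num.sqrt (14 / 15) :> R by apply: sqrtr_ge0.
have w1_le1 : Num.sqrt (14 / 15) <= 1 :> R by rewrite -[leRHS]sqrtr1 ler_wsqrtr; lra.
(* Each m is the threshold of one upper bound: m0^2 = 2 - sqrt 3 solves x (4 - x) = 1, m1^2 = 4 /
   15, and 1 / 2 is the least leg of an isosceles triangle with unit base. *)
have h0 s : m0 <= s -> p_at c0 mu s <= 12 / 25.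
  apply: p_at_12_25 => //; rewrite m02.
  have -> : (2 - b) * (4 - (2 - b)) = 4 - b ^+ 2 by ring.
  by rewrite b2; lra.
have h1 s : m1 <= s -> p_at c0 mu s <= 15 / 31.
  move=> ms; apply: p_at_15_31 => //; last lra.
  by rewrite -m12 ler_pXn2r // ?nnegrE; lra.
have h2 s : 1 / 2 <= s -> p_at c0 mu s <= 1 / 2 by apply: p_at_half.
rewrite -/a -/b; do !split.
- move=> d_le; suff : (13 / 25 - 12 / 25) / 2 <= p_at c0 mu d by lra.
  apply: (@p_at_ge _ _ _ _ _ _ _ _ _ _ _ _ _ _ h0) => //; rewrite -/b ?w0 ?bm0; lra.
- move=> d_gt d_le; suff : (13 / 25 - 15 / 31) / 2 <= p_at c0 mu d by lra.
  apply: (@p_at_ge _ _ _ _ _ _ _ _ _ _ _ _ _ _ h1) => //; rewrite -/b ?w1 ?bm1; lra.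
- move=> d_gt d_le; suff : (13 / 25 - 1 / 2) / 2 <= p_at c0 mu d by lra.
  apply: (@p_at_ge _ _ _ _ _ _ _ _ _ _ _ _ _ _ h2) => //; rewrite -/b ?w2; lra.
- move=> d_ge d_lt; suff : (13 / 25 - 1 / 2) / 2 <= p_at c0 mu d by lra.
  apply: (@p_at_ge _ _ _ _ _ _ _ _ _ _ _ _ _ _ h2) => //; rewrite -/b ?w2; lra.
- move=> d_ge d_lt; suff : (13 / 25 - 15 / 31) / 2 <= p_at c0 mu d by lra.
  apply: (@p_at_ge _ _ _ _ _ _ _ _ _ _ _ _ _ _ h1) => //; rewrite -/b ?w1 ?bm1; lra.
- move=> d_ge d_lt; suff : (13 / 25 - 12 / 25) / 2 <= p_at c0 mu d by lra.
  apply: (@p_at_ge _ _ _ _ _ _ _ _ _ _ _ _ _ _ h0) => //; rewrite -/b ?w0 ?bm0; lra.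
Qed.
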